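(* There exist a zero-dimensional compact metric space $(X,\varrho)$ and a nonempty closed subspace $A\subset X$ such that there is no extension operator for Lipschitz pseudometrics from $A$ to $X$, i.e. there is no map $u\colon \mathcal{PM}_{\mathrm{Lip}}(A)\to \mathcal{PM}_{\mathrm{Lip}}(X)$ satisfying all of the following: (1) $u(d_1+d_2)=u(d_1)+u(d_2)$ and $u(\lambda d)=\lambda u(d)$ for all $d_1,d_2,d\in \mathcal{PM}_{\mathrm{Lip}}(A)$ and all real $\lambda\ge 0$; (2) $u(d)|_{A\times A}=d$ for every $d\in\mathcal{PM}_{\mathrm{Lip}}(A)$; (3) $\sup\{\|u(d)\|_X \mid d\in \mathcal{PM}_{\mathrm{Lip}}(A),\ \|d\|_A\le 1\}<\infty$.
   Context: A topological space is zero-dimensional if its topology has a base consisting of sets that are both open and closed. Let $(X,\varrho)$ be a compact metric space. For a nonempty closed subset $B\subset X$ (in particular $B=A$ or $B=X$), a pseudometric $d$ on $B$ is called Lipschitz if there is $C>0$ with $d(x,y)\le C\varrho(x,y)$ for all $x,y\in B$. The set of all Lipschitz pseudometrics on $B$ is denoted $\mathcal{PM}_{\mathrm{Lip}}(B)$; it is a cone under pointwise addition and multiplication by nonnegative scalars. For $d\in\mathcal{PM}_{\mathrm{Lip}}(B)$ put $\|d\|_B=\sup\{d(x,y)/\varrho(x,y)\mid x,y\in B,\ x\ne y\}$ (with the value $0$ if $B$ is a single point). *)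

(* Defs.v *)
From HB Require Import structures.
From mathcomp Require Import all_boot all_order all_algebra.
From mathcomp Require Import all_classical all_reals all_analysis.

Set Implicit Arguments.
Unset Strict Implicit.
Unset Printing Implicit Defensive.

Import Order.TTheory GRing.Theory Num.Theory.

Local Open Scope classical_set_scope.
Local Open Scope ring_scope.

(* The library predicate [zero_dimensional] only asks that distinct points be
   separated by a clopen set; here a base of clopen sets is required. *)
Definition zero_dim (T : topologicalType) : Prop :=
  exists2 B : set (set T), basis B & B `<=` clopen.

(* A subset, as a type, already carries the induced pseudometric structure of
   the library; this adds the restricted distance, making it a metric space. *)
Section subset_metric.
Context {R : realType} {X : metricType R} (A : set X).

Let dist (x y : A) : R := mdist (\val x) (\val y).

Let dist_ge0 x y : 0 <= dist x y.
Proof. exact: mdist_ge0. Qed.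

Let dist_positivity x y : dist x y = 0 -> x = y.
Proof. by move/mdist_positivity/val_inj. Qed.

Let ballEdist x e : ball x e = [set y | dist x y < e].
Proof.
apply/seteqP; split => y.
  by rewrite /ball/= /initial_ball/= ballEmdist.
by move=> /= xye; rewrite /ball/= /initial_ball/= ballEmdist.
Qed.

HB.instance Definition _ :=
  @PseudoMetric_isMetric.Build R (A : Type) dist dist_ge0 dist_positivity
    ballEdist.

End subset_metric.

Section lipschitz_pseudometrics.
Context {R : realType}.

Definition pseudometric (T : Type) (d : T -> T -> R) : Prop :=
  [/\ forall x y, 0 <= d x y,
      forall x, d x x = 0,
      forall x y, d x y = d y x &
      forall x y z, d x z <= d x y + d y z].

Definition PMLip (T : metricType R) : set (T -> T -> R) :=
  [set d | pseudometric d /\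
           exists2 C : R, 0 < C & forall x y, d x y <= C * mdist x y].

Arguments PMLip T _ : clear implicits.

(* [sup set0 = 0], which is the intended value on a one-point space. *)
Definition lip_norm (T : metricType R) (d : T -> T -> R) : R :=
  sup [set d xy.1 xy.2 / mdist xy.1 xy.2
      | xy in [set xy : T * T | xy.1 <> xy.2]].

(* An element of [{fun PMLip A >-> PMLip X}] is a function on all of
   [A -> A -> R] that sends [PMLip A] into [PMLip X]; no condition below
   involves its values outside [PMLip A]. *)
Definition extension_operator (X : metricType R) (A : set X)
    (u : {fun PMLip A >-> PMLip X}) : Prop :=
  [/\ forall d1 d2, PMLip A d1 -> PMLip A d2 ->
        u (fun x y => d1 x y + d2 x y) = (fun x y => u d1 x y + u d2 x y),
      forall (a : R) d, 0 <= a -> PMLip A d ->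
        u (fun x y => a * d x y) = (fun x y => a * u d x y),
      forall d, PMLip A d -> forall x y : A, u d (\val x) (\val y) = d x y &
      (ereal_sup [set (lip_norm (u d))%:E
                 | d in [set d | PMLip A d /\ (lip_norm d <= 1)%R]] < +oo)%E].

End lipschitz_pseudometrics.

Arguments PMLip {R} T _.

(* Main.v *)
(* Let V be the set of subsets S of I, |I| = n, give the grid N^V the l1 metric, and
   let A be spanned by the n vectors w_i = (1 if i in S, else 0)_S. By
   Khintchine's inequality |a - b|_2 is comparable on A to l1 / |V|, so the sum of
   the n pseudometrics d_i = |a_i - b_i| is at most of order sqrt n * l1 / |V|. An
   additive bounded extension operator with constant K turns them into
   pseudometrics D_i on the grid whose sum is at most of order
   K * sqrt n * l1 / |V|. Averaged over translates, D_i(x, x + w_i) is still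
   about 1, because D_i equals d_i along A; on the other hand a path of unit steps
   from x to x + w_i bounds the sum over i of these averages by |V| times the
   bound for one unit step, that is by K * sqrt n. Hence n = O(K * sqrt n), which
   fails for n large. Finite boxes of such grids, rescaled and converging to a
   point, form one countable compact space containing all these obstructions. *)

Require Import Defs.
From HB Require Import structures.
From mathcomp Require Import all_boot all_order all_algebra.
From mathcomp Require Import all_classical all_reals all_analysis.
From mathcomp Require Import ring lra.

Set Implicit Arguments.
Unset Strict Implicit.
Unset Printing Implicit Defensive.

Import Order.TTheory GRing.Theory Num.Theory.

Local Open Scope classical_set_scope.
Local Open Scope ring_scope.

(** * Khintchine's inequality *)

Section khinchine.
Context {R : rcfType} {I : finType}.
Local Notation subset := {ffun I -> bool}.
Local Notation N := (#|subset|%:R : R).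
Implicit Types (S : subset) (J : seq I) (a : I -> R).

Definition flip (j : I) S : subset := [ffun i => S i (+) (i == j)].

Lemma flipK j : involutive (flip j).
Proof. by move=> S; apply/ffunP => i; rewrite !ffunE addbK. Qed.

(** Reindexing by [flip j] fixes [g] and reverses the sign, so the sum equals its own opposite. This
    is how terms odd in one random sign vanish below. *)
Lemma sum_sign_flip_inv j (g : subset -> R) :
  (forall S, g (flip j S) = g S) -> \sum_(S : subset) (-1) ^+ S j * g S = 0.
Proof.
move=> gj; set s := LHS; suff : s = - s by move=> ?; lra.
rewrite {1}/s (reindex_inj (inv_inj (flipK j))) -sumrN; apply: eq_bigr => S _.
by rewrite gj ffunE eqxx addbT signrN mulNr.
Qed.

(** For uniformly random [S] the signs [(-1) ^+ S i] are independent. Summing along a list [J]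
    allows moments to be computed by adding one sign at a time. *)
Definition rademacher a J S : R := \sum_(i <- J) (-1) ^+ S i * a i.

Lemma rademacher_flip a J j S : j \notin J ->
  rademacher a J (flip j S) = rademacher a J S.
Proof.
move=> jJ; apply: eq_big_seq => i iJ; rewrite ffunE.
by case: eqVneq iJ jJ => [->->//|_ _ _]; rewrite addbF.
Qed.

Lemma rademacher_moment2 a J : uniq J ->
  \sum_(S : subset) rademacher a J S ^+ 2 = N * \sum_(i <- J) a i ^+ 2.
Proof.
elim: J => [_|j J IH /= /andP[jJ /IH {}IH]].
  rewrite big_nil mulr0 big1// => S _.
  by rewrite /rademacher big_nil expr0n.
rewrite big_cons mulrDr -IH.
have -> : \sum_(S : subset) rademacher a (j :: J) S ^+ 2 =
    \sum_(S : subset) (a j ^+ 2 + (-1) ^+ S j * (2 * a j * rademacher a J S)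
            + rademacher a J S ^+ 2).
  apply: eq_bigr => S _; rewrite /rademacher big_cons.
  by case: (S j); rewrite ?expr1 ?expr0; ring.
rewrite 2!big_split/= sum_sign_flip_inv => [|S]; last by rewrite rademacher_flip.
by rewrite addr0 sumr_const mulr_natl.
Qed.

Lemma rademacher_moment4 a J : uniq J ->
  \sum_(S : subset) rademacher a J S ^+ 4 <=
  3 * N * (\sum_(i <- J) a i ^+ 2) ^+ 2.
Proof.
elim: J => [_|j J IH /= /andP[jJ uJ]].
  rewrite big_nil big1 ?mulr0 ?expr0n ?mulr0// => S _.
  by rewrite /rademacher big_nil expr0n.
have -> : \sum_(S : subset) rademacher a (j :: J) S ^+ 4 =
    \sum_(S : subset) (a j ^+ 4 + 6 * a j ^+ 2 * rademacher a J S ^+ 2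
      + (-1) ^+ S j * (4 * a j ^+ 3 * rademacher a J S
                       + 4 * a j * rademacher a J S ^+ 3)
      + rademacher a J S ^+ 4).
  apply: eq_bigr => S _; rewrite /rademacher big_cons.
  by case: (S j); rewrite ?expr1 ?expr0; ring.
rewrite 3!big_split/= sum_sign_flip_inv => [|S]; last by rewrite rademacher_flip.
rewrite addr0 sumr_const -[_ *+ #|_|]mulr_natl -mulr_sumr.
rewrite rademacher_moment2// big_cons.
have := IH uJ; move: (\sum_(S : subset) _) (\sum_(i <- J) _) => M4 M2.
(* After the odd terms vanish, [a j ^+ 4 + 6 * a j ^+ 2 * s + 3 * s ^+ 2] is compared with
   [3 * (a j ^+ 2 + s) ^+ 2], where [s] is the sum of squares over [J]; the slack is
   [2 * a j ^+ 4]. *)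
have : 0 <= N * a j ^+ 4.
  by rewrite mulr_ge0// exprn_even_ge0.
move: N => c.
by lra.
Qed.

(* Averages [|x| >= 3/2 x^2 / t - 1/2 x^4 / t^3]; the scale [t = 2 sigma] is close
   enough to the optimal [sqrt 3 sigma]. *)
Lemma rademacher_moment1 a :
  N * Num.sqrt (\sum_i a i ^+ 2) <=
  2 * \sum_(S : subset) `|rademacher a (index_enum I) S|.
Proof.
set M2 := \sum_i _; set s := Num.sqrt _.
have M2_ge0 : 0 <= M2 by apply: sumr_ge0 => i _; exact: sqr_ge0.
have sE : M2 = s ^+ 2 by rewrite sqr_sqrtr.
have [s0|s0] := ltrP 0 s; last first.
  have -> : s = 0 by apply/eqP; rewrite eq_le s0 sqrtr_ge0.
  by rewrite mulr0 mulr_ge0// sumr_ge0.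
have sn0 : s != 0 by rewrite gt_eqF.
have key x : 3 / 4 / s * x ^+ 2 - (16 * s ^+ 3)^-1 * x ^+ 4 <= `|x|.
  set r := `|x| / (2 * s).
  have r0 : 0 <= r by rewrite divr_ge0// mulr_ge0// ltW.
  have xE : `|x| = 2 * s * r by rewrite /r; field; exact: sn0.
  have -> : x ^+ 2 = (2 * s * r) ^+ 2 by rewrite -xE real_normK ?num_real.
  have -> : x ^+ 4 = (2 * s * r) ^+ 4.
    by rewrite -xE -[4%N]/(2 * 2)%N !exprM real_normK ?num_real.
  have -> : 3 / 4 / s * (2 * s * r) ^+ 2 - (16 * s ^+ 3)^-1 * (2 * s * r) ^+ 4 =
      s * (3 * r ^+ 2 - r ^+ 4) by field; exact: sn0.
  (* With [r = |x| / t], the claim is [r^3 - 3 r + 2 >= 0], multiplied by [r]; the cubic has a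
     double root at 1. *)
  rewrite xE -subr_ge0.
  have -> : 2 * s * r - s * (3 * r ^+ 2 - r ^+ 4) =
      s * (r * ((r - 1) ^+ 2 * (r + 2))) by ring.
  apply: mulr_ge0 (ltW s0) (mulr_ge0 r0 (mulr_ge0 (sqr_ge0 _) _)).
  exact: addr_ge0.
have /(ler_sum (index_enum _)) : forall S, true ->
    3 / 4 / s * rademacher a (index_enum I) S ^+ 2
    - (16 * s ^+ 3)^-1 * rademacher a (index_enum I) S ^+ 4
    <= `|rademacher a (index_enum I) S| by move=> S _; exact: key.
rewrite sumrB -!mulr_sumr rademacher_moment2 ?index_enum_uniq// -/M2 => le1.
have := @rademacher_moment4 a _ (index_enum_uniq I).
rewrite -/M2 => le4.
have {}le4 : (16 * s ^+ 3)^-1 *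
    (\sum_(S : subset) rademacher a (index_enum I) S ^+ 4)
   <= (16 * s ^+ 3)^-1 * (3 * N * M2 ^+ 2).
  by rewrite ler_wpM2l// invr_ge0 mulr_ge0// exprn_ge0// ltW.
have e2 : 3 / 4 / s * (N * M2) = 3 / 4 * (N * s) by rewrite sE; field; exact: sn0.
have e4 : (16 * s ^+ 3)^-1 * (3 * N * M2 ^+ 2) = 3 / 16 * (N * s).
  by rewrite sE; field; exact: sn0.
rewrite e2 in le1; rewrite e4 in le4.
(* The two moments leave [3/4 - 3/16 = 9/16], which exceeds the required [1/2]. *)
have : 0 <= N * s by rewrite mulr_ge0// ltW.
lra.
Qed.

(** A signed sum is, up to sign, the sum over [S] minus the sum over its complement, and
    complementation permutes the subsets. *)
Lemma subset_sum_moment1 a :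
  \sum_(S : subset) `|rademacher a (index_enum I) S| <=
  2 * \sum_(S : subset) `|\sum_i (S i)%:R * a i|.
Proof.
pose neg S : subset := [ffun i => ~~ S i].
have negK : involutive neg by move=> S; apply/ffunP => i; rewrite !ffunE negbK.
rewrite mulrDl mul1r [X in _ <= _ + X](reindex_inj (inv_inj negK)) -big_split/=.
apply: ler_sum => S _; rewrite -normrN.
rewrite (_ : - _ = \sum_i (S i)%:R * a i - \sum_i (neg S i)%:R * a i).
  exact: ler_normB.
rewrite /rademacher -sumrN -sumrB; apply: eq_bigr => i _; rewrite ffunE.
by case: (S i); rewrite /= ?expr1 ?expr0; ring.
Qed.

(** Cauchy-Schwarz against the constant vector, obtained by expanding the sum of all
    [(|a i| - |a j|)^2]. *)
Lemma l1_le_sqrt_card_l2 a :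
  \sum_i `|a i| <= Num.sqrt #|I|%:R * Num.sqrt (\sum_i a i ^+ 2).
Proof.
set q := Num.sqrt #|I|%:R; set s := Num.sqrt _.
have qE : q ^+ 2 = #|I|%:R by rewrite sqr_sqrtr.
have sE : s ^+ 2 = \sum_i a i ^+ 2.
  by rewrite sqr_sqrtr// sumr_ge0// => i _; exact: sqr_ge0.
have q0 : 0 <= q by exact: sqrtr_ge0.
have s0 : 0 <= s by exact: sqrtr_ge0.
suff : (\sum_i `|a i|) ^+ 2 <= (q * s) ^+ 2.
  by rewrite ler_sqr ?nnegrE ?mulr_ge0// sumr_ge0.
have : 0 <= \sum_i \sum_j (`|a i| - `|a j|) ^+ 2.
  by apply: sumr_ge0 => i _; apply: sumr_ge0 => j _; exact: sqr_ge0.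
have uE : s ^+ 2 = \sum_i `|a i| ^+ 2.
  by rewrite sE; apply: eq_bigr => i _; rewrite real_normK ?num_real.
have sum_cst (x : R) : \sum_(i : I) x = q ^+ 2 * x.
  by rewrite sumr_const qE mulr_natl.
have -> : \sum_i \sum_j (`|a i| - `|a j|) ^+ 2 =
    2 * (q * s) ^+ 2 - 2 * (\sum_i `|a i|) ^+ 2.
  transitivity (\sum_i (q ^+ 2 * `|a i| ^+ 2 + s ^+ 2
                        - 2 * (\sum_j `|a j|) * `|a i|)).
    apply: eq_bigr => i _; rewrite -sum_cst uE mulrAC mulr_sumr.
    by rewrite -big_split -sumrB; apply: eq_bigr => j _ /=; ring.
  by rewrite sumrB big_split/= -!mulr_sumr -uE sum_cst; ring.
by lra.
Qed.

(** Chains the three preceding bounds; 4 is the product of the factors 2 in [rademacher_moment1] and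
    [subset_sum_moment1]. *)
Lemma l1_le_subset_sums a :
  N * \sum_i `|a i| <=
  4 * Num.sqrt #|I|%:R * \sum_(S : subset) `|\sum_i (S i)%:R * a i|.
Proof.
have := rademacher_moment1 a; have := subset_sum_moment1 a.
have := l1_le_sqrt_card_l2 a; set q := Num.sqrt #|I|%:R; set s := Num.sqrt _.
move=> h1 h2 h3; have q0 : 0 <= q by exact: sqrtr_ge0.
have {h2}h3 := le_trans h3 (ler_wpM2l (ler0n _ 2) h2).
have := ler_wpM2l q0 h3; have := ler_wpM2l (ler0n R #|subset|) h1.
by lra.
Qed.

End khinchine.

(** * Averaging pseudometrics on a grid *)

Lemma sum_inj_le {R : numDomainType} {A B : finType} (f : A -> B) (F : B -> R) :
  injective f -> (forall b, 0 <= F b) -> \sum_a F (f a) <= \sum_b F b.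
Proof.
move=> fI F0; rewrite -(big_image _ _ _ xpredT)/= big_uniq/=; last first.
  by rewrite map_inj_uniq ?enum_uniq.
by rewrite [leRHS](bigID (mem (codom f)))/= lerDl sumr_ge0.
Qed.

Lemma pseudometric_path {R : realType} {T : Type} (d : T -> T -> R)
    (f : nat -> T) n :
  pseudometric d -> d (f 0) (f n) <= \sum_(k < n) d (f k) (f k.+1).
Proof.
move=> [_ d0 _ dT]; elim: n => [|n IH]; first by rewrite big_ord0 d0.
by rewrite big_ord_recr/= (le_trans (dT _ (f n) _))// lerD2r.
Qed.

Section update.
Context {I J : finType}.

Definition update (a : {ffun I -> J}) (i : I) (j : J) : {ffun I -> J} :=
  [ffun k => if k == i then j else a k].

(** Exchanging the new value [j] with the discarded value [a i] is an involution on the pairs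
    [(a, j)]. *)
Lemma sum_update {R : pzSemiRingType} i (h : {ffun I -> J} -> R) :
  \sum_a \sum_j h (update a i j) = #|J|%:R * \sum_a h a.
Proof.
pose s (p : {ffun I -> J} * J) := (update p.1 i p.2, p.1 i).
have sK : involutive s.
  move=> [a j]; congr pair; rewrite /= ?ffunE ?eqxx//.
  by apply/ffunP => k; rewrite !ffunE; case: eqP => [->|].
rewrite pair_big/= (reindex_inj (inv_inj sK))/=.
rewrite (eq_bigr (fun p => h p.1)) => [|p _]; last by rewrite -[p in RHS]sK.
rewrite -(pair_big xpredT xpredT (fun a _ => h a))/= mulr_sumr.
by apply: eq_bigr => a _; rewrite sumr_const mulr_natl.
Qed.

End update.

Section averaging.
Context {R : realType} {I : finType}.
Local Notation V := {ffun I -> bool}.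
Local Notation grid := {ffun V -> nat}.
Implicit Types (S : V) (x y : grid).

Definition l1dist x y : R := \sum_S `|(x S)%:R - (y S)%:R|.

(** The combination of the vectors w_i with coefficients [a]; [basis_sums i] is w_i itself. *)
Definition subset_sums (a : I -> nat) : grid := [ffun S : V => (\sum_i S i * a i)%N].

Definition basis_sums (i : I) : grid := [ffun S : V => S i : nat].

Definition box_pt m (z : {ffun V -> 'I_m}) : grid := [ffun S => z S : nat].

Definition indic (s : seq V) : grid := [ffun S => (S \in s) : nat].

Lemma l1dist_box m (z : {ffun V -> 'I_m}) x :
  l1dist x (box_pt z + x) <= #|V|%:R * m%:R.
Proof.
rewrite mulr_natl -sumr_const; apply: ler_sum => S _; rewrite !ffunE natrD.
rewrite distrC addrK ger0_norm// ler_nat; exact/ltnW.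
Qed.

Lemma l1dist_indic1 S x : l1dist x (x + indic [:: S]) = 1.
Proof.
rewrite /l1dist (bigD1 S)//= big1 => [|S' S'S]; rewrite !ffunE !inE.
  by rewrite eqxx natrD distrC addrAC subrr add0r normr1 addr0.
by rewrite (negPf S'S) addr0 subrr normr0.
Qed.

Lemma subset_sums_update (P : nat) (a : {ffun I -> 'I_P}) i (j : 'I_P) :
  subset_sums (fun k => update a i j k) =
  subset_sums (fun k => if k == i then j : nat else a k).
Proof.
apply/ffunP => S; rewrite !ffunE; apply: eq_bigr => k _; rewrite ffunE.
by case: ifP.
Qed.

Lemma subset_sums_basis (a : I -> nat) i n :
  subset_sums (fun k => if k == i then n else a k) + basis_sums i =
  subset_sums (fun k => if k == i then n.+1 else a k).
Proof.
apply/ffunP => S; rewrite !ffunE (bigD1 i)//= [in RHS](bigD1 i)//= !eqxx.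
rewrite mulnSr -[LHS]/(_ + _)%N addnAC; congr (_ + _)%N.
by apply: eq_bigr => k /negPf ->.
Qed.

(* Telescope along [P] steps in the direction [basis_sums i]: the offset [z] is
   paid for only at the two ends, hence is negligible for [P] large. *)
Lemma average_basis_step_ge (D : grid -> grid -> R) (c : R) (i : I) (P m : nat)
    (z : {ffun V -> 'I_m}) : 0 <= c ->
  pseudometric D -> (forall x y, D x y <= c * l1dist x y) ->
  (forall a b, (forall k, a k <= P)%N -> (forall k, b k <= P)%N ->
     D (subset_sums a) (subset_sums b) = `|(a i)%:R - (b i)%:R|) ->
  #|{ffun I -> 'I_P}|%:R * (P%:R - 2 * c * (#|V|%:R * m%:R)) <=
  P%:R * \sum_(a : {ffun I -> 'I_P})
    D (box_pt z + subset_sums (fun k => a k))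
      (box_pt z + subset_sums (fun k => a k) + basis_sums i).
Proof.
move=> c0 Dp Dc Da; have [_ _ Ds Dt] := Dp.
(* Resampling the [i]-th coefficient splits the sum over [a] into full paths of [P] consecutive
   steps, one for each [a]. *)
have := sum_update i (fun a : {ffun I -> 'I_P} => D
  (box_pt z + subset_sums (fun k => a k))
  (box_pt z + subset_sums (fun k => a k) + basis_sums i)).
rewrite card_ord => <-.
rewrite mulr_natl -sumr_const; apply: ler_sum => a _.
pose f (n : nat) := subset_sums (fun k => if k == i then n else a k).
rewrite (eq_bigr (fun j : 'I_P => D (box_pt z + f j) (box_pt z + f j.+1)));
    last first.
  by move=> j _; rewrite -addrA subset_sums_update subset_sums_basis.
apply: le_trans (pseudometric_path (fun n => box_pt z + f n) P Dp).
have f0P : D (f 0) (f P) = P%:R.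
  rewrite Da ?eqxx ?sub0r ?normrN ?ger0_norm// => k.
  - by case: ifP => // _; exact: ltnW.
  - by case: ifP => // _; exact: ltnW.
have close x : D x (box_pt z + x) <= c * (#|V|%:R * m%:R).
  by rewrite (le_trans (Dc _ _))// ler_wpM2l// l1dist_box.
have := Dt (f 0) (box_pt z + f 0) (f P); have := close (f 0).
have := Dt (box_pt z + f 0) (box_pt z + f P) (f P); have := close (f P).
rewrite (Ds (f P)) f0P.
lra.
Qed.

(** Walk from [x] to [x + indic s] one coordinate at a time. The part already walked is absorbed
    into the offset, injectively, and raises each coordinate by at most 1; hence [m.+1] on the
    right. *)
Lemma average_indic_step_le (D : grid -> grid -> R) (m : nat) (v : grid)
    (s : seq V) :
  pseudometric D -> uniq s ->
  \sum_(z : {ffun V -> 'I_m}) D (box_pt z + v) (box_pt z + v + indic s) <=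
  \sum_(S <- s) \sum_(z : {ffun V -> 'I_m.+1})
    D (box_pt z + v) (box_pt z + v + indic [:: S]).
Proof.
move=> [D0 Dxx _ Dt]; elim: s => [_|S s IH /= /andP[Ss us]].
  rewrite big_nil big1// => z _.
  have -> : indic [::] = 0 by apply/ffunP => S; rewrite !ffunE.
  by rewrite addr0.
rewrite big_cons addrC.
have indic_cons : indic (S :: s) = indic s + indic [:: S].
  apply/ffunP => S'; rewrite !ffunE !inE.
  by case: eqVneq => [->|_]; rewrite ?(negPf Ss) ?addr0.
apply: le_trans (lerD (IH us) (lexx _)).
pose shift (z : {ffun V -> 'I_m}) : {ffun V -> 'I_m.+1} :=
  [ffun S' => inord (z S' + (S' \in s))].
have shiftE z S' : shift z S' = (z S' + (S' \in s))%N :> nat.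
  rewrite ffunE inordK// ltnS; case: (S' \in s); rewrite ?addn1 ?addn0//.
  exact/ltnW.
have shiftI : injective shift.
  move=> z z' zz'; apply/ffunP => S'; apply/val_inj/eqP.
  by rewrite -(eqn_add2r (S' \in s)) -!shiftE zz'.
pose F (z : {ffun V -> 'I_m.+1}) := D (box_pt z + v) (box_pt z + v + indic [:: S]).
apply: le_trans (lerD (lexx _) (sum_inj_le shiftI (F := F) (fun z => D0 _ _))).
rewrite -big_split; apply: ler_sum => z _ /=; rewrite /F.
have -> : box_pt (shift z) + v = box_pt z + v + indic s.
  apply/ffunP => S'; rewrite ffunE [box_pt (shift z) S']ffunE shiftE !ffunE.
  by rewrite [RHS]addrAC.
by rewrite indic_cons addrA.
Qed.

(** Two estimates of [Q], the total [D i]-length of the steps w_i over all base points: from below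
    by telescoping along [A], from above by unit steps. *)
Lemma sum_pseudometrics_dimension_bound (D : I -> grid -> grid -> R) (c : R)
    (P m : nat) :
  0 <= c -> (0 < P)%N ->
  (forall i, pseudometric (D i)) ->
  (forall x y, \sum_i D i x y <= c * l1dist x y) ->
  (forall i a b, (forall k, a k <= P)%N -> (forall k, b k <= P)%N ->
     D i (subset_sums a) (subset_sums b) = `|(a i)%:R - (b i)%:R|) ->
  #|I|%:R * (P%:R - 2 * c * (#|V|%:R * m%:R)) * m%:R ^+ #|V| <=
  P%:R * c * #|V|%:R * m.+1%:R ^+ #|V|.
Proof.
move=> c0 P0 Dp Dc Da.
have D0 i x y : 0 <= D i x y by case: (Dp i).
pose Q := \sum_i \sum_(a : {ffun I -> 'I_P}) \sum_(z : {ffun V -> 'I_m})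
    D i (box_pt z + subset_sums (fun k => a k))
      (box_pt z + subset_sums (fun k => a k) + basis_sums i).
have lower : #|I|%:R * (#|{ffun V -> 'I_m}|%:R * (#|{ffun I -> 'I_P}|%:R *
    (P%:R - 2 * c * (#|V|%:R * m%:R)))) <= P%:R * Q.
  rewrite /Q mulr_sumr mulr_natl -sumr_const; apply: ler_sum => i _.
  rewrite exchange_big/= mulr_sumr mulr_natl -sumr_const; apply: ler_sum => z _.
  apply: average_basis_step_ge => //; last by move=> *; exact: Da.
  move=> x y; apply: le_trans (Dc x y); rewrite (bigD1 i)//= lerDl.
  exact: sumr_ge0.
have upper : Q <=
    #|{ffun I -> 'I_P}|%:R * (#|V|%:R * (#|{ffun V -> 'I_m.+1}|%:R * c)).
  rewrite /Q exchange_big/= mulr_natl -sumr_const; apply: ler_sum => a _.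
  set v := subset_sums _.
  (* Enlarging the range from the [S] containing [i] to all [S] makes it independent of [i], so the
     sum over [i] can move innermost, where [Dc] applies to a step of length 1. *)
  apply: (@le_trans _ _ (\sum_i \sum_S \sum_(z : {ffun V -> 'I_m.+1})
      D i (box_pt z + v) (box_pt z + v + indic [:: S]))).
    apply: ler_sum => i _; pose s := [seq S : V <- index_enum V | S i].
    have -> : basis_sums i = indic s.
      by apply/ffunP => S; rewrite !ffunE mem_filter mem_index_enum andbT.
    apply: le_trans (average_indic_step_le _ _ (Dp i) _) _.
      by rewrite filter_uniq ?index_enum_uniq.
    rewrite big_filter [leRHS](bigID (fun S : V => S i))/= lerDl.
    by apply: sumr_ge0 => S _; apply: sumr_ge0.
  rewrite exchange_big/= mulr_natl -sumr_const; apply: ler_sum => S _.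
  rewrite exchange_big/= mulr_natl -sumr_const; apply: ler_sum => z _.
  by rewrite (le_trans (Dc _ _))// l1dist_indic1 mulr1.
have K0 : 0 < #|{ffun I -> 'I_P}|%:R :> R.
  by rewrite ltr0n card_ffun card_ord expn_gt0 P0.
rewrite -(ler_pM2l K0).
have := le_trans lower (ler_wpM2l (ler0n R P) upper).
rewrite (card_ffun V 'I_m) (card_ffun V 'I_m.+1) !card_ord !natrX.
set p := P%:R - _; set w := #|V|%:R; set M := m%:R ^+ _.
set M' := m.+1%:R ^+ _; clearbody p w M M' => h.
rewrite (_ : _ * (_ * M) = #|I|%:R * (M * (#|{ffun I -> 'I_P}|%:R * p)));
    last by ring.
by apply: le_trans h _; rewrite le_eqVlt; apply/orP; left; apply/eqP; ring.
Qed.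

End averaging.

(** * Finite metric spaces converging to a point *)

Section bouquet.
Context {R : realType} (T : nat -> finType) (r : forall n, T n -> T n -> R).

(** The diameter bound ensures that a detour through a point outside [T n] never shortens a distance
    inside [T n]. *)
Definition shrinking_metrics : Prop :=
  forall n, [/\ pseudometric (@r n), forall x y, r x y = 0 -> x = y :> T n &
                forall x y : T n, r x y <= n.+1%:R^-1].

(* The finite metric spaces [T n] together with a point [None] to which they
   converge; [n.+1%:R^-1] is the distance from [None] to every point of [T n]. *)
Definition bouquet (rP : shrinking_metrics) : Type := option {n & T n}.

Variable rP : shrinking_metrics.

HB.instance Definition _ := Choice.on (bouquet rP).

Let s (n : nat) : R := n.+1%:R^-1.

Let rho (p q : bouquet rP) : R :=
  match p, q with
  | None, None => 0
  | Some u, None | None, Some u => s (tag u)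
  | Some u, Some v =>
    if tag u == tag v then r (tagged u) (tagged_as u v)
    else s (tag u) + s (tag v)
  end.

Let s_gt0 n : 0 < s n. Proof. by rewrite invr_gt0. Qed.

Let rho_same n (x y : T n) : rho (Some (Tagged T x)) (Some (Tagged T y)) = r x y.
Proof. by rewrite /= eqxx tagged_asE. Qed.

Let rho_diff n m (x : T n) (y : T m) : n != m ->
  rho (Some (Tagged T x)) (Some (Tagged T y)) = s n + s m.
Proof. by move=> /negPf nm; rewrite /= nm. Qed.

Let rhoxx p : rho p p = 0.
Proof.
case: p => [[n x]|//]; rewrite rho_same.
by have [[_ -> _ _] _ _] := rP n.
Qed.

Let rho_positivity p q : rho p q = 0 -> p = q.
Proof.
case: p q => [[n x]|] [[m y]|] //=; last 2 first.
- by move/eqP; rewrite gt_eqF.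
- by move/eqP; rewrite gt_eqF.
have [nm|nm] := eqVneq n m; last first.
  by move/eqP; rewrite gt_eqF// addr_gt0.
case: m / nm y => y; rewrite tagged_asE; have [_ r0 _] := rP n.
by move/r0 ->.
Qed.

Let rho_sym p q : rho p q = rho q p.
Proof.
case: p q => [[n x]|] [[m y]|] //.
have [nm|nm] := eqVneq n m; last first.
  by rewrite (rho_diff _ _ nm) rho_diff 1?addrC// eq_sym.
by case: m / nm y => y; rewrite !rho_same; have [[_ _ -> _] _ _] := rP n.
Qed.

Let rho_triangle q p t : rho p t <= rho p q + rho q t.
Proof.
have r_ge0 n (x y : T n) : 0 <= r x y by have [[]] := rP n.
have r_le n (x y : T n) : r x y <= s n by have [] := rP n.
case: p t => [[n x]|] [[m y]|]; case: q => [[k z]|].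
- have [nm|nm] := eqVneq n m.
    case: m / nm y => y; rewrite rho_same; have [nk|nk] := eqVneq n k.
      by case: k / nk z => z; rewrite !rho_same; have [[_ _ _ ->] _ _] := rP n.
    rewrite !rho_diff// 1?eq_sym//.
    have := r_le n x y; have := s_gt0 n; have := s_gt0 k; lra.
  rewrite (rho_diff _ _ nm); have [nk|nk] := eqVneq n k.
    case: k / nk z => z; rewrite rho_same rho_diff//.
    by have := r_ge0 n x z; lra.
  have [km|km] := eqVneq k m.
    case: m / km y nm => y nm; rewrite rho_same rho_diff//.
    by have := r_ge0 k z y; lra.
  by rewrite !rho_diff//; have := s_gt0 k; lra.
- have [nm|nm] := eqVneq n m; last by rewrite rho_diff.
  case: m / nm y => y; rewrite rho_same /=.
  have := r_le n x y; have := s_gt0 n; lra.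
- rewrite [leLHS]/=; have [nk|nk] := eqVneq n k.
    by case: k / nk z => z; rewrite rho_same /=; have := r_ge0 n x z; lra.
  by rewrite rho_diff//=; have := s_gt0 k; lra.
- by rewrite /=; lra.
- rewrite [leLHS]/=; have [nk|nk] := eqVneq k m.
    by case: m / nk y => y; rewrite rho_same /=; have := r_ge0 k z y; lra.
  by rewrite rho_diff//=; have := s_gt0 k; lra.
- by rewrite /=; lra.
- by rewrite /=; have := s_gt0 k; lra.
- by rewrite /=; lra.
Qed.

HB.instance Definition _ := @isMetric.Build R (bouquet rP) rho rhoxx
  rho_positivity rho_sym rho_triangle.

Definition petal n (x : T n) : bouquet rP := Some (Tagged T x).

Definition hub : bouquet rP := None.

Lemma bouquetP (p : bouquet rP) : p = hub \/ exists n (x : T n), p = petal x.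
Proof. by case: p => [[n x]|]; [right; exists n, x|left]. Qed.

Lemma mdist_petal n (x y : T n) : mdist (petal x) (petal y) = r x y.
Proof. exact: rho_same. Qed.

Lemma mdist_petal_neq n m (x : T n) (y : T m) : n != m ->
  mdist (petal x) (petal y) = n.+1%:R^-1 + m.+1%:R^-1.
Proof. exact: rho_diff. Qed.

Lemma mdist_petal_hub n (x : T n) : mdist (petal x) hub = n.+1%:R^-1.
Proof. by []. Qed.

Let finite_level n : finite_set (range (@petal n)).
Proof. exact/finite_image/finite_finset. Qed.

Let accessible_bouquet : accessible_space (bouquet rP).
Proof. exact: hausdorff_accessible (@metric_hausdorff R (bouquet rP)). Qed.

(** Points other than [hub] are isolated: the ball of radius [n.+1%:R^-1] around a point of [T n]
    stays in the finite set [T n]. *)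
Lemma bouquet_open (U : set (bouquet rP)) : ~ U hub -> open U.
Proof.
move=> U0; rewrite openE => p Up.
have [pE|[n [x pE]]] := bouquetP p; first by rewrite pE in Up.
rewrite /interior; pose F := range (@petal n) `\ p.
have nF : nbhs p (~` F).
  apply: open_nbhs_nbhs; split; last by move=> [_ /(_ erefl)].
  apply: closed_openC; move/accessible_finite_set_closed: accessible_bouquet.
  by apply; exact: finite_setD.
have nB : nbhs p (ball p (n.+1%:R^-1 : R)) by exact: nbhsx_ballx.
apply: filterS (filterI nF nB) => q [/= Fq]; rewrite ballEmdist/= pE => pq.
have [qE|[m [y qE]]] := bouquetP q.
  by move: pq; rewrite qE mdist_petal_hub ltxx.
have [nm|nm] := eqVneq n m; last first.
  by move: pq; rewrite qE mdist_petal_neq// gtrDl ltNge (ltW (s_gt0 m)).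
case: m / nm y qE => y qE.
apply: contrapT => Uq; apply: Fq; split; first by exists y.
by move=> qp; apply: Uq; rewrite qp.
Qed.

Lemma bouquet_closed (U : set (bouquet rP)) : U hub -> closed U.
Proof. by move=> U0; rewrite -openC; apply: bouquet_open => /(_ U0). Qed.

Lemma bouquet_cofinite (U : set (bouquet rP)) : nbhs hub U -> finite_set (~` U).
Proof.
move=> /nbhs_ballP[e /= e0 eU].
have [M eM] : exists M, forall n, (M <= n)%N -> n.+1%:R^-1 < e.
  exists (Num.truncn e^-1) => n Mn; rewrite invf_plt ?posrE//.
  by rewrite (lt_le_trans (truncnS_gt _))// ler_nat.
apply: (@sub_finite_set _ _ (\bigcup_(n in `I_M) range (@petal n))).
  move=> p Up; have [pE|[n [x pE]]] := bouquetP p.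
    by exfalso; apply/Up/eU; rewrite pE; exact: ballxx.
  exists n; last by exists x.
  rewrite /= ltnNge; apply/negP => Mn; apply/Up/eU.
  by rewrite ballEmdist /= metric_sym pE mdist_petal_hub; exact: eM.
exact: bigcup_finite.
Qed.

(** If a filter does not cluster at [hub], it contains the complement of a neighbourhood of [hub],
    which is finite and hence compact. *)
Lemma bouquet_compact : compact [set: bouquet rP].
Proof.
move=> F FF _; have [cF|] := pselect (cluster F hub); first by exists hub.
move=> /existsNP[A /existsNP[B /not_implyP[FA /not_implyP[nB AB]]]].
have [|p [_ cp]] := @finite_compact _ (~` B) (bouquet_cofinite nB) F FF.
  by apply: filterS FA => p Ap Bp; apply: AB; exists p.
by exists p.
Qed.

(** Open sets containing [hub] are automatically closed, and all other singletons are clopen. *)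
Lemma bouquet_zero_dim : zero_dim (bouquet rP).
Proof.
exists clopen => //; split=> [U []//|p U /nbhs_interior].
have [pE|[n [x pE]]] := bouquetP p => nU.
  exists U°; last exact: interior_subset.
  split; last exact: nbhs_singleton nU.
  split; first exact: open_interior.
  by apply: bouquet_closed; rewrite -pE; exact: nbhs_singleton nU.
exists [set p]; last by move=> q ->; exact: interior_subset (nbhs_singleton nU).
split=> //; split; first by apply: bouquet_open; rewrite pE.
exact: accessible_closed_set1.
Qed.

End bouquet.

(** * Bounds for extension operators *)

Section extension_operators.
Context {R : realType}.

Lemma pseudometric_sum {T : Type} {J : Type} (s : seq J) (d : J -> T -> T -> R) :
  (forall j, pseudometric (d j)) -> pseudometric (fun x y => \sum_(j <- s) d j x y).
Proof.
move=> dP; split=> [x y|x|x y|x y z].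
- by apply: sumr_ge0 => j _; have [d0 _ _ _] := dP j; exact: d0.
- by apply: big1 => j _; have [_ -> _ _] := dP j.
- by apply: eq_bigr => j _; have [_ _ -> _] := dP j.
- by rewrite -big_split; apply: ler_sum => j _; have [_ _ _ dt] := dP j; exact: dt.
Qed.

Lemma PMLip_sum {T : metricType R} {J : Type} (s : seq J) (d : J -> T -> T -> R) :
  (forall j, PMLip T (d j)) -> PMLip T (fun x y => \sum_(j <- s) d j x y).
Proof.
move=> dP; split; first by apply: pseudometric_sum => j; have [] := dP j.
elim: s => [|j s [C C0 IH]].
  by exists 1 => // x y; rewrite big_nil mul1r mdist_ge0.
have [_ [C' C'0 dC']] := dP j; exists (C' + C); first exact: addr_gt0.
by move=> x y; rewrite big_cons mulrDl lerD.
Qed.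

Lemma PMLip_scale {T : metricType R} (a : R) (d : T -> T -> R) :
  0 <= a -> PMLip T d -> PMLip T (fun x y => a * d x y).
Proof.
move=> a0 [[d0 dxx ds dt] [C C0 dC]]; split; last first.
  exists (a * C + 1) => [|x y]; first by rewrite ltr_wpDl// mulr_ge0// ltW.
  by rewrite mulrDl -mulrA mul1r ler_wpDr ?mdist_ge0// ler_wpM2l.
split=> [x y|x|x y|x y z]; first exact: mulr_ge0.
- by rewrite dxx mulr0.
- by rewrite ds.
- by rewrite -mulrDr ler_wpM2l.
Qed.

Lemma le_lip_norm {T : metricType R} (d : T -> T -> R) x y :
  PMLip T d -> d x y <= lip_norm d * mdist x y.
Proof.
move=> [[_ dxx _ _] [C C0 dC]]; have [->|/eqP xy] := eqVneq x y.
  by rewrite dxx mdistxx mulr0.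
have m0 (p q : T) : p <> q -> 0 < mdist p q by move=> /eqP; rewrite mdist_gt0.
rewrite -ler_pdivrMr ?m0//; apply: ub_le_sup; last by exists (x, y).
exists C => _ [[p q] /= pq <-]; by rewrite ler_pdivrMr ?m0.
Qed.

Lemma lip_norm_le {T : metricType R} (d : T -> T -> R) (C : R) : 0 <= C ->
  (forall x y, d x y <= C * mdist x y) -> lip_norm d <= C.
Proof.
move=> C0 dC; rewrite /lip_norm; set E := (X in sup X).
(* Without two distinct points there are no quotients, and the supremum takes its default value
   0. *)
have [->|/set0P E0] := eqVneq E set0; first by rewrite sup0.
apply: ge_sup => // _ [[p q] /= /eqP pq <-].
by rewrite ler_pdivrMr// mdist_gt0.
Qed.

Context {X : metricType R} {A : set X} (u : {fun PMLip A >-> PMLip X}).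
Hypothesis uE : extension_operator u.

Lemma extension_operator_bound : exists2 K : R, 0 < K &
  forall d (C : R), PMLip A d -> 0 < C -> (forall x y, d x y <= C * mdist x y) ->
    forall x y, u d x y <= K * C * mdist x y.
Proof.
have [_ uZ _ ufin] := uE.
set E := (X in ereal_sup X) in ufin.
(* The maximum with 1 makes the constant positive; homogeneity reduces the claim to [C^-1 * d],
   which lies in the unit ball. *)
exists (Num.max 1 (fine (ereal_sup E))) => [|d C dP C0 dC x y].
  by rewrite lt_max ltr01.
set K := Num.max _ _; have Ci0 : 0 <= C^-1 by rewrite invr_ge0 ltW.
pose d' := fun x y => C^-1 * d x y.
have d'P : PMLip A d' by exact: PMLip_scale.
have : lip_norm (u d') <= K.
  have E' : E (lip_norm (u d'))%:E.
    exists d' => //; split=> //; apply: lip_norm_le => // p q.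
    by rewrite mul1r /d' ler_pdivrMl.
  have := ereal_sup_ubound E'; rewrite /K; move: ufin.
  case: (ereal_sup E) => [r _|//|//].
  by rewrite lee_fin/= le_max orbC => ->.
move=> uK; have ud'P : PMLip X (u d') by exact: funS.
have := le_trans (le_lip_norm x y ud'P) (ler_wpM2r (mdist_ge0 x y) uK).
by rewrite uZ// ler_pdivrMl// mulrA [C * K]mulrC.
Qed.

Lemma extension_operator_sum {J : Type} (s : seq J) (d : J -> A -> A -> R) x y :
  (forall j, PMLip A (d j)) ->
  u (fun p q => \sum_(j <- s) d j p q) x y = \sum_(j <- s) u (d j) x y.
Proof.
move=> dP; have [uD uZ _ _] := uE; elim: s => [|j s IH].
  (* Homogeneity with factor 0 yields the image of the zero pseudometric. *)
  rewrite (_ : (fun p q => _) = (fun p q : A => 0 * 0)).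
    rewrite uZ ?big_nil ?mul0r//; split; first by split=> // *; rewrite addr0.
    by exists 1 => // p q; rewrite mul1r mdist_ge0.
  by apply/funext => p; apply/funext => q; rewrite big_nil mul0r.
rewrite (_ : (fun p q => _) =
  (fun p q : A => d j p q + (\sum_(j <- s) d j p q))).
  by rewrite uD ?big_cons ?IH//; exact: PMLip_sum.
by apply/funext => p; apply/funext => q; rewrite big_cons.
Qed.

End extension_operators.

(** * The counterexample *)

Section bouquet_of_boxes.
Context {R : realType}.
Local Notation V n := {ffun 'I_n -> bool}.
Local Notation grid n := {ffun V n -> nat}.

(* Large enough to contain [subset_sums a] for all [a i <= n * (2 * #|V n|)]. *)
Definition box_len (n : nat) : nat := (n * (n * (2 * #|V n|)))%N.

Definition box (n : nat) : finType := {ffun V n -> 'I_(box_len n).+1}.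

(** The last two factors bound the l1 diameter of the box, so the rescaled box has diameter at most
    [n.+1%:R^-1]. The successor of [box_len n] keeps the scale positive when [n = 0]. *)
Definition box_scale (n : nat) : R := n.+1%:R * (#|V n|%:R * (box_len n).+1%:R).

Lemma box_scale_gt0 n : 0 < box_scale n.
Proof. by rewrite !mulr_gt0// ltr0n card_ffun expn_gt0 card_bool. Qed.

Definition box_dist n (x y : box n) : R :=
  l1dist (box_pt x) (box_pt y) / box_scale n.

Lemma l1dist_pseudometric (I : finType) :
  pseudometric (@l1dist R I).
Proof.
split=> [x y|x|x y|x y z]; first exact: sumr_ge0.
- by apply: big1 => S _; rewrite subrr normr0.
- by apply: eq_bigr => S _; rewrite distrC.
- by rewrite -big_split; apply: ler_sum => S _; exact: ler_distD.
Qed.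

Lemma l1dist_eq0 (I : finType) (x y : {ffun {ffun I -> bool} -> nat}) :
  l1dist x y = 0 :> R -> x = y.
Proof.
move=> /eqP; rewrite psumr_eq0// => /allP xy; apply/ffunP => S.
have := xy S (mem_index_enum _); rewrite normr_eq0 subr_eq0 eqr_nat.
by move/eqP.
Qed.

Lemma l1dist_le_pt (I : finType) (x y : {ffun {ffun I -> bool} -> nat}) S :
  `|(x S)%:R - (y S)%:R| <= l1dist x y :> R.
Proof. by rewrite /l1dist (bigD1 S)//= lerDl sumr_ge0. Qed.

Lemma box_distP : shrinking_metrics box_dist.
Proof.
move=> n; have [l0 lxx ls lt] := l1dist_pseudometric 'I_n.
have si0 : 0 <= (box_scale n)^-1 by rewrite invr_ge0 ltW// box_scale_gt0.
split=> [|x y|x y].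
- split=> [x y|x|x y|x y z]; rewrite /box_dist.
  + exact: mulr_ge0.
  + by rewrite lxx mul0r.
  + by rewrite ls.
  + by rewrite -mulrDl ler_wpM2r.
- move=> /eqP; rewrite mulf_eq0 invr_eq0 (gt_eqF (box_scale_gt0 n)) orbF.
  move=> /eqP/l1dist_eq0/ffunP xy; apply/ffunP => S; apply/val_inj.
  by have := xy S; rewrite !ffunE.
- rewrite ler_pdivrMr ?box_scale_gt0// mulrA mulVf ?pnatr_eq0// mul1r.
  rewrite mulr_natl -sumr_const; apply: ler_sum => S _; rewrite !ffunE.
  have := ltnW (ltn_ord (x S)); have := ltnW (ltn_ord (y S)).
  rewrite -!(ler_nat R) ler_norml; move: (_.+1%:R) => L yL xL.
  by have := ler0n R (x S); have := ler0n R (y S); lra.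
Qed.

Definition box_bouquet : metricType R := bouquet box_distP.

(* The retraction onto the [n]-th box that sends all other boxes to the origin. *)
Definition level (n : nat) (p : box_bouquet) : grid n :=
  if p is Some v then untag 0 (@box_pt 'I_n (box_len n).+1) v else 0.

Lemma level_petal n (x : box n) : level n (petal box_distP x) = box_pt x.
Proof.
rewrite /= (untagE _ _ (erefl : tag (Tagged box x) = n)).
by [].
Qed.

Lemma level_petal_neq n m (x : box m) : m != n -> level n (petal box_distP x) = 0.
Proof. by move=> mn; rewrite /= untag_dflt. Qed.

Lemma level_cases n (p : box_bouquet) :
  (exists x : box n, p = petal box_distP x) \/
  level n p = 0 /\ forall x : box n, n.+1%:R^-1 <= mdist (petal box_distP x) p.
Proof.
have [->|[m [y ->]]] := bouquetP p.
  by right; split=> // x; rewrite mdist_petal_hub.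
have [mn|mn] := eqVneq m n; first by case: n / mn; left; exists y.
right; split=> [|x]; first exact: level_petal_neq.
by rewrite mdist_petal_neq 1?eq_sym// lerDl invr_ge0.
Qed.

(** The jump to 0 off the [n]-th box is harmless: points of the box have l1 size at most
    [box_scale n / n.+1%:R], and their distance to the outside is at least [n.+1%:R^-1]. *)
Lemma l1dist_level n (p q : box_bouquet) :
  l1dist (level n p) (level n q) <= box_scale n * mdist p q.
Proof.
have [l0 lxx ls lt] := l1dist_pseudometric 'I_n.
have s0 := box_scale_gt0 n.
have far (x : box n) q' : level n q' = 0 ->
    n.+1%:R^-1 <= mdist (petal box_distP x) q' ->
    l1dist (level n (petal box_distP x)) (level n q') <=
    box_scale n * mdist (petal box_distP x) q'.
  move=> -> /(ler_wpM2l (ltW s0)); apply: le_trans.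
  rewrite level_petal /box_scale mulrAC mulfV ?pnatr_eq0// mul1r.
  rewrite mulr_natl -sumr_const; apply: ler_sum => S _; rewrite !ffunE subr0.
  by rewrite ger0_norm// ler_nat ltnW.
have [[x ->]|[p0 pn]] := level_cases n p; have [[y ->]|[q0 qn]] := level_cases n q.
- by rewrite !level_petal mdist_petal /box_dist mulrC divfK// gt_eqF.
- exact: far.
- by rewrite ls metric_sym; exact: far.
- by rewrite p0 q0 lxx mulr_ge0 ?mdist_ge0// ltW.
Qed.

(** A 1-Lipschitz retraction of the grid onto the box; it pulls pseudometrics back to the whole
    grid, where translation is unrestricted. *)
Definition clamp (n : nat) (x : grid n) : box n :=
  [ffun S => inord (minn (x S) (box_len n))].

Lemma clampE n (x : grid n) S : clamp x S = minn (x S) (box_len n) :> nat.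
Proof. by rewrite ffunE inordK// ltnS geq_minr. Qed.

Lemma l1dist_clamp n (x y : grid n) :
  l1dist (box_pt (clamp x)) (box_pt (clamp y)) <= l1dist x y :> R.
Proof.
apply: ler_sum => S _; rewrite ![box_pt _ S]ffunE !clampE.
move: (x S) (y S) (box_len n) => a b L.
have h1 : a%:R - b%:R <= `|a%:R - b%:R| :> R by exact: ler_norm.
have h2 : b%:R - a%:R <= `|a%:R - b%:R| :> R by rewrite distrC ler_norm.
rewrite ler_norml /minn; case: ltnP => aL; case: ltnP => bL.
- lra.
- move: h1 h2 (ltnW aL) bL; rewrite -!(ler_nat R).
  lra.
- move: h1 h2 aL (ltnW bL); rewrite -!(ler_nat R).
  lra.
- by rewrite subrr oppr_le0 normr_ge0.
Qed.

Lemma box_pt_clamp n (x : grid n) :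
  (forall S, x S <= box_len n)%N -> box_pt (clamp x) = x.
Proof.
by move=> xL; apply/ffunP => S; rewrite ffunE clampE (minn_idPl _).
Qed.

(** Since [level n] is 0 off the [n]-th box, only the box containing [p] imposes a condition: the
    set is [hub] together with the lattice points of each box. *)
Definition terminals : set box_bouquet :=
  [set p | forall n, exists a : 'I_n -> nat, level n p = subset_sums a].

Lemma subset_sums0 n : subset_sums (fun _ : 'I_n => 0%N) = 0.
Proof. by apply/ffunP => S; rewrite !ffunE big1// => i _; rewrite muln0. Qed.

Lemma terminals_hub : terminals (hub box_distP).
Proof. by move=> n; exists (fun=> 0%N); rewrite subset_sums0. Qed.

Lemma terminals_petal n (x : box n) (a : 'I_n -> nat) :
  box_pt x = subset_sums a -> terminals (petal box_distP x).
Proof.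
move=> xa m; have [nm|nm] := eqVneq n m.
  by case: m / nm; exists a; rewrite level_petal.
by exists (fun=> 0%N); rewrite subset_sums0 level_petal_neq.
Qed.

(** The coordinate at the singleton of [i] recovers [a i] from [subset_sums a]. *)
Definition singleton_pt (I : finType) (i : I) : {ffun I -> bool} :=
  [ffun k => k == i].

Lemma subset_sums_singleton (I : finType) (a : I -> nat) i :
  subset_sums a (singleton_pt i) = a i.
Proof.
rewrite ffunE (bigD1 i)//= ffunE eqxx mul1n big1 ?addn0// => k /negPf ki.
by rewrite ffunE ki.
Qed.

(** Khintchine's inequality for [a - b], whose subset sums are the coordinates of the difference of
    the two grid points. *)
Lemma l1_le_l1dist_subset_sums (I : finType) (a b : I -> nat) :
  \sum_i `|(a i)%:R - (b i)%:R| <=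
  4 * Num.sqrt #|I|%:R / #|{ffun I -> bool}|%:R *
  l1dist (subset_sums a) (subset_sums b) :> R.
Proof.
have N0 : 0 < #|{ffun I -> bool}|%:R :> R.
  by rewrite ltr0n card_ffun expn_gt0 card_bool.
rewrite mulrAC ler_pdivlMr// mulrC.
apply: le_trans (l1_le_subset_sums (fun i => (a i)%:R - (b i)%:R : R)) _.
rewrite le_eqVlt; apply/orP; left; apply/eqP; congr (_ * _).
apply: eq_bigr => S _; rewrite !ffunE !natr_sum -sumrB; congr `|_|.
by apply: eq_bigr => i _; rewrite !natrM mulrBr.
Qed.

End bouquet_of_boxes.

(** A division-free form of [(1 + 1/m)^k <= m / (m - k)]; the induction step is
    [m (m - k) - (m - k - 1) (m + 1) = k + 1]. For [m = 2 k] it shows that enlarging the offset box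
    by one at most doubles its size. *)
Lemma succ_expn_le {R : numDomainType} (m k : nat) :
  (m%:R - k%:R) * m.+1%:R ^+ k <= m%:R ^+ k.+1 :> R.
Proof.
elim: k => [|k IH]; first by rewrite subr0 expr0 mulr1 expr1.
rewrite exprS mulrA [leRHS]exprS; apply: le_trans (ler_wpM2l (ler0n _ m) IH).
rewrite mulrA ler_wpM2r ?exprn_ge0// -subr_ge0.
rewrite (_ : _ - _ = k.+1%:R)// -[m.+1]addn1 -[k.+1]addn1 !natrD; ring.
Qed.

(** Both sides share the factor [q^2 m M]; what remains is [q^2 - 8 K q <= 8 K q]. *)
Lemma dimension_bound_arith {F : realFieldType} (q K k N m M P : F) :
  0 < q -> 0 < m -> 0 < M -> k * N = 4 * q -> P = q ^+ 2 * m ->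
  q ^+ 2 * (P - 2 * (K * k) * (N * m)) * M <= P * (K * k) * N * (2 * M) ->
  q <= 16 * K.
Proof.
move=> q0 m0 M0 kN ->.
rewrite (_ : _ * M = (q ^+ 2 - 2 * K * (k * N)) * (q ^+ 2 * m * M)); last by ring.
rewrite (_ : _ * (2 * M) = 2 * K * (k * N) * (q ^+ 2 * m * M)); last by ring.
rewrite kN ler_pM2r; last by rewrite !mulr_gt0// exprn_gt0.
rewrite (_ : _ - _ = (q - 8 * K) * q); last by ring.
rewrite (_ : 2 * K * (4 * q) = 8 * K * q); last by ring.
rewrite ler_pM2r//; lra.
Qed.

(** * Lower bound for the constant of an extension operator *)

Section no_extension_operator.
Context {R : realType}.
Local Notation X := (@box_bouquet R).
Local Notation A := (@terminals R).
Local Notation V n := {ffun 'I_n -> bool}.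

(** The pseudometrics d_i, pulled back along [level n] to all of [A]. *)
Definition coord_dist (n : nat) (i : 'I_n) (p q : A) : R :=
  `|(level n (\val p) (singleton_pt i))%:R - (level n (\val q) (singleton_pt i))%:R|.

Lemma coord_dist_PMLip n (i : 'I_n) : PMLip A (coord_dist i).
Proof.
split; last first.
  exists (box_scale n) => [|p q]; first exact: box_scale_gt0.
  exact: le_trans (l1dist_le_pt _ _ _) (l1dist_level n (\val p) (\val q)).
split=> [p q|p|p q|p q t]; rewrite /coord_dist.
- exact: normr_ge0.
- by rewrite subrr normr0.
- by rewrite distrC.
- exact: ler_distD.
Qed.

Lemma sum_coord_dist_le n (p q : A) :
  \sum_(i < n) coord_dist i p q <=
  4 * Num.sqrt n%:R / #|V n|%:R * box_scale n * mdist p q.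
Proof.
case: p q => [p Ap] [q Aq]; have /= := set_mem Ap; have /= := set_mem Aq.
move=> /(_ n)[b qb] /(_ n)[a pa].
rewrite (eq_bigr (fun i => `|(a i)%:R - (b i)%:R|)); last first.
  by move=> i _; rewrite /coord_dist /= pa qb !subset_sums_singleton.
apply: le_trans (l1_le_l1dist_subset_sums a b) _; rewrite card_ord -[leRHS]mulrA.
rewrite ler_wpM2l ?divr_ge0 ?mulr_ge0 ?sqrtr_ge0// -pa -qb.
exact: l1dist_level.
Qed.

Context (u : {fun PMLip A >-> PMLip X}).
Hypothesis uE : extension_operator u.

Lemma extension_operator_dimension_bound (K : R) n : (0 < n)%N ->
  (forall d (C : R), PMLip A d -> 0 < C -> (forall x y, d x y <= C * mdist x y) ->
    forall x y, u d x y <= K * C * mdist x y) -> 0 < K ->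
  Num.sqrt n%:R < 64 * K.
Proof.
move=> n0 uK K0; set q := Num.sqrt n%:R.
have qE : q ^+ 2 = n%:R by rewrite sqr_sqrtr.
have q0 : 0 < q by rewrite sqrtr_gt0 ltr0n.
have N0 : (0 < #|V n|)%N by rewrite card_ffun expn_gt0 card_bool.
set N := #|V n| in N0 *.
have NR0 : 0 < N%:R :> R by rewrite ltr0n.
have s0 := @box_scale_gt0 R n.
pose k := 4 * q / N%:R; have k0 : 0 < k by rewrite divr_gt0 ?mulr_gt0.
have uLip i : PMLip X (u (@coord_dist n i)) by exact: funS (coord_dist_PMLip i).
pose e x := petal box_distP (@clamp n x) : X.
pose D (i : 'I_n) x y := u (coord_dist i) (e x) (e y).
have Dp i : pseudometric (D i).
  have [[d0 dxx ds dt] _] := uLip i.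
  by split=> *; [exact: d0|exact: dxx|exact: ds|exact: dt].
have Dle x y : \sum_i D i x y <= K * k * l1dist x y.
  (* By additivity the bound on [u] is applied once, to the sum, whose Lipschitz constant on [A] is
     at most [k * box_scale n]. *)
  rewrite -(extension_operator_sum uE)//; last exact: coord_dist_PMLip.
  apply: le_trans (uK _ (k * box_scale n) _ _ _ _ _) _.
  - by apply: PMLip_sum => i; exact: coord_dist_PMLip.
  - exact: mulr_gt0.
  - exact: sum_coord_dist_le.
  - rewrite mdist_petal /box_dist; set l := l1dist (box_pt _) _.
    rewrite (_ : _ * (l / _) = K * k * l); last by field; rewrite gt_eqF.
    by rewrite ler_wpM2l ?l1dist_clamp//; exact/ltW/mulr_gt0.
(* [m = 2 N] gives [(m + 1)^N <= 2 m^N]; [P = n m] outweighs the end cost [2 K k N m = 8 K q m] once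
   [q] is large compared with [K]. *)
pose m := (2 * N)%N; pose P := (n * m)%N.
have De i a b : (forall j, a j <= P)%N -> (forall j, b j <= P)%N ->
    D i (subset_sums a) (subset_sums b) = `|(a i)%:R - (b i)%:R|.
  have small c : (forall j, c j <= P)%N ->
      box_pt (clamp (subset_sums c)) = subset_sums c :> {ffun V n -> nat}.
    move=> cP; apply: box_pt_clamp => S; rewrite ffunE /box_len.
    rewrite -[leqRHS]/(n * P)%N -[in leqRHS](card_ord n) -sum_nat_const.
    by apply: leq_sum => j _; case: (S j); rewrite ?mul1n// mul0n.
  pose inA c cP : A := exist (fun p => p \in A) _
    (mem_set (@terminals_petal R n _ c (small c cP))).
  move=> aP bP; have [_ _ ud _] := uE.
  have := ud _ (coord_dist_PMLip i) (inA a aP) (inA b bP).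
  by rewrite /D /e /= => ->; rewrite /coord_dist !level_petal !small//
    !subset_sums_singleton.
have P0 : (0 < P)%N by rewrite !muln_gt0 n0 N0.
have Kk0 : 0 <= K * k by exact/ltW/mulr_gt0.
have := sum_pseudometrics_dimension_bound m Kk0 P0 Dp Dle De.
rewrite card_ord -/N -qE.
have kN : k * N%:R = 4 * q by rewrite /k divfK ?gt_eqF.
have mE : m%:R = 2 * N%:R :> R by rewrite /m natrM.
have PE : P%:R = q ^+ 2 * m%:R by rewrite /P natrM qE.
have pow : m.+1%:R ^+ N <= 2 * m%:R ^+ N :> R.
  have := @succ_expn_le R m N; rewrite exprS mE.
  rewrite (_ : 2 * N%:R - N%:R = N%:R); last by ring.
  by rewrite [2 * _]mulrC -!mulrA ler_pM2l.
move=> h; rewrite ltNge; apply/negP => Kq.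
have m0 : 0 < m%:R :> R by rewrite mE mulr_gt0.
have M0 : 0 < m%:R ^+ N :> R by rewrite exprn_gt0.
have c0 : 0 <= P%:R * (K * k) * N%:R by rewrite !mulr_ge0// ltW.
have {}h := le_trans h (ler_wpM2l c0 pow).
(* The assumption [64 * K <= q] now gives [64 * K <= 16 * K]. *)
have := le_trans Kq (dimension_bound_arith q0 m0 M0 kN PE h).
by rewrite ler_pM2r// ler_nat.
Qed.

End no_extension_operator.

Theorem theorem4p1 (R : realType) :
  exists (X : metricType R) (A : set X),
    [/\ compact [set: X], zero_dim X, closed A, A !=set0 &
        ~ exists u : {fun PMLip A >-> PMLip X}, extension_operator u].
Proof.
exists (@box_bouquet R), (@terminals R); split.
- exact: bouquet_compact.
- exact: bouquet_zero_dim.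
- apply: bouquet_closed; exact: terminals_hub.
- by exists (hub box_distP); exact: terminals_hub.
move=> [u uE]; have [K K0 uK] := extension_operator_bound uE.
(* Chosen so that [n] exceeds [(64 * K)^2]. *)
pose n := (Num.truncn ((64 * K) ^+ 2)).+1.
have := extension_operator_dimension_bound uE (ltn0Sn _ : (0 < n)%N) uK K0.
apply/negP; rewrite -leNgt -[leLHS]ger0_norm; last by rewrite mulr_ge0// ltW.
by rewrite -sqrtr_sqr ler_wsqrtr// ltW// truncnS_gt.
Qed.
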